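(* Let $R(x)=g(x)/h(x)$ be a rational expression of degree $r\ge 1$ over $\mathbb{F}_q$. Let $A(x)$ and $B(x)$ be linear rational expressions over $\mathbb{F}_q$, and write $(B\circ R\circ A)(x)=\tilde R(x)=\tilde g(x)/\tilde h(x)$. Then for every integer $n>1$ we have \[ |\mathcal{I}(\tilde g,\tilde h,n,q)|=|\mathcal{I}(g,h,n,q)|. \]
   Context: A rational expression over $\mathbb{F}_q$ is written $R(x)=g(x)/h(x)$ with $g,h\in\mathbb{F}_q[x]$ coprime (likewise $\tilde g,\tilde h$ are coprime); its degree is $\max(\deg g,\deg h)$. A linear rational expression is one of degree $1$ (a Möbius transformation $x\mapsto (ax+b)/(cx+d)$ with $ad-bc\neq0$). $\circ$ denotes composition of rational expressions. For an integer $n>1$, $\mathcal{I}(g,h,n,q)$ denotes the set of monic irreducible polynomials $f\in\mathbb{F}_q[x]$ of degree $n$ such that $h(x)^n f\bigl(g(x)/h(x)\bigr)$ is irreducible in $\mathbb{F}_q[x]$. *)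

(* Defs.v *)
From HB Require Import structures.
From mathcomp Require Import all_boot all_order all_algebra.
Set Implicit Arguments.
Unset Strict Implicit.
Unset Printing Implicit Defensive.
Import GRing.Theory.
Local Open Scope ring_scope.

Notation "p %:F" := (FracField.tofrac p) : ring_scope.

Notation "{ 'ratexpr' F }" := {fraction {poly F}}
  (at level 0, format "{ 'ratexpr'  F }") : type_scope.

Section RationalExpressions.
Variable F : fieldType.
Implicit Types (f g h p q : {poly F}) (S T : {ratexpr F}).

Definition lowest_terms T g h : Prop :=
  [/\ h != 0, coprimep g h & T = g%:F / h%:F].

(* [repr T] need not be reduced, hence the division by the gcd. *)
Definition rnum T : {poly F} :=
  \n_(repr T) %/ gcdp \n_(repr T) \d_(repr T).
Definition rden T : {poly F} :=
  \d_(repr T) %/ gcdp \n_(repr T) \d_(repr T).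

Definition rdeg T : nat := maxn (size (rnum T)).-1 (size (rden T)).-1.

Definition linear_ratexpr T : Prop := rdeg T = 1%N.

Definition reval p T : {ratexpr F} :=
  (map_poly (fun c : F => (c%:P)%:F) p).[T].

(* [rcomp S T] is S o T.  As division is total, the value is only meaningful
   when the reduced denominator of S does not vanish at T, which is always so
   for nonconstant T. *)
Definition rcomp S T : {ratexpr F} := reval (rnum S) T / reval (rden S) T.

(* The polynomial h^n f(g/h) for f of degree at most n: see [hsubstE]. *)
Definition hsubst n f g h : {poly F} :=
  \sum_(i < n.+1) f`_i *: (g ^+ i * h ^+ (n - i)).

Lemma hsubstE n f g h : h != 0 -> (size f <= n.+1)%N ->
  (hsubst n f g h)%:F = h%:F ^+ n * reval f (g%:F / h%:F).
Proof.
move=> h0 sf; have hF0 : h%:F != 0 by rewrite tofrac_eq0.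
rewrite /reval (@horner_coef_wide _ n.+1); last first.
  by rewrite (leq_trans (size_poly _ _)).
rewrite mulr_sumr rmorph_sum /=; apply: eq_bigr => i _.
rewrite coef_map_id0 ?polyC0 ?tofrac0 // -mul_polyC !tofracM !tofracXn.
rewrite [RHS]mulrCA; congr (_ * _); rewrite expr_div_n [RHS]mulrCA; congr (_ * _).
have le_in : (i <= n)%N by rewrite -ltnS.
by apply: (canRL (mulfK _)); rewrite ?expf_neq0 // -exprD subnK.
Qed.

Lemma rnum_rden_lowest T : lowest_terms T (rnum T) (rden T).
Proof.
rewrite /rnum /rden; set x := repr T.
have d0 : \d_x != 0 by exact: denom_ratioP.
have g0 : gcdp \n_x \d_x != 0 by rewrite gcdp_eq0 negb_and d0 orbT.
split.
- by rewrite dvdp_div_eq0 ?dvdp_gcdr.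
- by rewrite coprimep_div_gcd // d0 orbT.
have -> : T = (\n_x)%:F / (\d_x)%:F.
  apply: (canRL (mulfK _)); first by rewrite tofrac_eq0.
  rewrite -[T]reprK -/x; unlock FracField.tofrac; rewrite -[LHS]FracField.pi_mul.
  apply/eqmodP; rewrite /= FracField.equivfE /FracField.mulf.
  by rewrite !numden_Ratio ?oner_eq0 ?mulf_neq0 ?oner_eq0 // !mulr1 mulrC.
apply/eqP; rewrite eqr_div ?tofrac_eq0 ?dvdp_div_eq0 ?dvdp_gcdr // -!tofracM.
by rewrite tofrac_eq divp_mulA ?dvdp_gcdr // divp_mulAC ?dvdp_gcdl.
Qed.

Lemma rdegE T g h : lowest_terms T g h ->
  rdeg T = maxn (size g).-1 (size h).-1.
Proof.
case=> h0 cgh Tgh; have [d0 cnd Tnd] := rnum_rden_lowest T.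
have E : rnum T * h = g * rden T.
  apply/eqP; rewrite -tofrac_eq !tofracM.
  by rewrite -eqr_div ?tofrac_eq0 // -Tnd -Tgh.
have Eh : rden T %= h.
  rewrite /eqp -(@Gauss_dvdpr _ _ (rnum T) (rden T)) 1?coprimep_sym // E.
  rewrite dvdp_mull //=.
  by rewrite -(@Gauss_dvdpr _ _ g h) 1?coprimep_sym // -E dvdp_mull.
have Eg : rnum T %= g.
  rewrite -(eqp_mul2r _ _ h0) E; apply: eqp_mull; exact: Eh.
by rewrite /rdeg (eqp_size Eh) (eqp_size Eg).
Qed.

End RationalExpressions.

(* Polynomials of degree n all live in the finite type {poly_(n.+1) F}. *)
Definition Iset (F : finFieldType) (g h : {poly F}) (n : nat) :
    {set {poly_(n.+1) F}} :=
  [set f : {poly_(n.+1) F} |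
    [&& size f == n.+1, val f \is monic, irreducibleb (val f) &
        irreducibleb (hsubst n (val f) g h)]].

(* Main.v *)
Require Import Defs.
From mathcomp Require Import all_boot all_order all_algebra ring.
Local Open Scope ring_scope.

(** For f of degree n, [hsubst n f g h] is the binary form
    f(X, Y) = Y^n f(X / Y) evaluated at the pair (g, h).  All the polynomials
    here, including the numerators and denominators of rational expressions,
    are handled as binary forms of a prescribed degree, so that the point at
    infinity needs no separate treatment: the substitution is multiplicative
    for such forms ([hsubstM]) and hence associative ([hsubst_comp]), and
    substituting a linear pair (u, v) of nonzero determinant is undone, up to
    a nonzero scalar, by substituting the adjugate pair ([hsubstK]).

    Write R = g / h, of degree r.  Precomposing with A = u / v replaces g and
    h by their transforms under (u, v); this pair is still coprime and of
    degree r ([reduced_pair_precomp]).  By associativity it replaces the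
    polynomial h^n f(g / h) by its transform under (u, v), as a form of
    degree n r.  An irreducible f with n > 1 has no root in the field, so the
    top coefficient of h^n f(g / h) does not vanish and its degree is exactly
    n r ([size_hsubst]), before and after the transformation.  An invertible
    substitution that preserves the degree preserves irreducibility
    ([irred_hsubstE]).  So precomposition does not change the set counted
    ([Iset_precomp]).

    Postcomposing with B = u / v replaces (g, h) by linear combinations, and
    by associativity h^n f(B(g / h)) becomes h^n f'(g / h), where f' is the
    transform of f under (u, v).  Again because f has no root, f' is
    irreducible of degree n, and sending f to the monic multiple of f' is
    injective.  This gives one inequality between the cardinals; the adjugate
    of B gives the other one ([card_Iset_postcomp]).

    Finally, two reduced fractions of one rational expression differ by a
    common scalar ([lowest_terms_uniq]), which the count ignores
    ([Iset_scale]). *)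

Section BinaryForms.
Set Implicit Arguments.
Unset Strict Implicit.
Import GRing.Theory.
Variable F : fieldType.
Implicit Types (f g h p q u v d : {poly F}).

(** * Substitution in binary forms *)

Lemma hsubstD n p q g h :
  hsubst n (p + q) g h = hsubst n p g h + hsubst n q g h.
Proof.
by rewrite /hsubst -big_split; apply: eq_bigr => i _; rewrite coefD scalerDl.
Qed.

Lemma hsubstZ n c f g h : hsubst n (c *: f) g h = c *: hsubst n f g h.
Proof.
by rewrite /hsubst scaler_sumr; apply: eq_bigr => i _; rewrite coefZ scalerA.
Qed.

Lemma hsubst_sum n I (r : seq I) (P : pred I) (E : I -> {poly F}) g h :
  hsubst n (\sum_(i <- r | P i) E i) g h =
  \sum_(i <- r | P i) hsubst n (E i) g h.
Proof.
have hsubst0 : hsubst n 0 g h = 0.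
  by rewrite -[X in hsubst n X](scale0r (0 : {poly F})) hsubstZ scale0r.
exact: (big_morph (fun f => hsubst n f g h)
         (fun p q => hsubstD n p q g h) hsubst0).
Qed.

Lemma hsubstXn n k g h : (k <= n)%N ->
  hsubst n 'X^k g h = g ^+ k * h ^+ (n - k).
Proof.
move=> le_kn; rewrite /hsubst (bigD1 (Ordinal (le_kn : (k < n.+1)%N))) //=.
rewrite coefXn eqxx scale1r big1 ?addr0 // => i neq_ik.
by rewrite coefXn (negPf (neq_ik : (i : nat) != k)) scale0r.
Qed.

Lemma poly_sum_monomials n f : (size f <= n)%N -> f = \sum_(i < n) f`_i *: 'X^i.
Proof.
move=> sf; rewrite -poly_def; apply/polyP => i; rewrite coef_poly.
by case: ltnP => // le_ni; rewrite nth_default // (leq_trans sf).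
Qed.

Lemma hsubst_scale n c f g h :
  hsubst n f (c *: g) (c *: h) = c ^+ n *: hsubst n f g h.
Proof.
rewrite /hsubst scaler_sumr; apply: eq_bigr => i _.
have le_in : (i <= n)%N by rewrite -ltnS.
by rewrite !exprZn -scalerAl -scalerAr !scalerA -mulrA -exprD subnKC // mulrC.
Qed.

(** The product of forms of degrees m and n is a form of degree m + n; both
    sides are bilinear, so monomials suffice. *)
Lemma hsubstM m n p q g h : (size p <= m.+1)%N -> (size q <= n.+1)%N ->
  hsubst (m + n) (p * q) g h = hsubst m p g h * hsubst n q g h.
Proof.
move=> sp sq; rewrite {1}(poly_sum_monomials sp) {1}(poly_sum_monomials sq).
rewrite mulr_suml hsubst_sum [RHS]mulr_suml; apply: eq_bigr => i _.
rewrite mulr_sumr hsubst_sum [RHS]mulr_sumr; apply: eq_bigr => j _.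
have le_im : (i <= m)%N by rewrite -ltnS.
have le_jn : (j <= n)%N by rewrite -ltnS.
rewrite -!scalerAl -!scalerAr -exprD !hsubstZ hsubstXn ?leq_add //.
by rewrite -[in RHS]mulrACA -!exprD addnBA // addnBAC // subnDA.
Qed.

Lemma hsubst1 g h : hsubst 0 1 g h = 1.
Proof.
by rewrite -[X in hsubst 0 X](expr0 'X) hsubstXn // subnn !expr0 mul1r.
Qed.

Lemma size_expr_leq r k g : (size g <= r.+1)%N ->
  (size (g ^+ k) <= (k * r).+1)%N.
Proof.
move=> sg; rewrite (leq_trans (leqSpred _)) // ltnS size_exp mulnC leq_mul2l.
by rewrite -subn1 leq_subLR add1n sg orbT.
Qed.

Lemma size_monom_leq r n i g h : (i <= n)%N ->
  (size g <= r.+1)%N -> (size h <= r.+1)%N ->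
  (size (g ^+ i * h ^+ (n - i) : {poly F})%R <= (n * r).+1)%N.
Proof.
move=> le_in sg sh; rewrite (leq_trans (size_polyMleq _ _)) //.
have := leq_add (size_expr_leq i sg) (size_expr_leq (n - i) sh).
by rewrite addSn addnS -mulnDl subnKC //; case: (_ + _)%N.
Qed.

Lemma size_hsubst_leq r n f g h : (size g <= r.+1)%N -> (size h <= r.+1)%N ->
  (size (hsubst n f g h) <= (n * r).+1)%N.
Proof.
move=> sg sh; rewrite (leq_trans (size_sum _ _ _)) //; apply/bigmax_leqP => i _.
by rewrite (leq_trans (size_scale_leq _ _)) // size_monom_leq // -ltnS.
Qed.

Lemma hsubst_exp r k g u v : (size g <= r.+1)%N ->
  hsubst (k * r) (g ^+ k) u v = hsubst r g u v ^+ k.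
Proof.
move=> sg; elim: k => [|k IHk]; first by rewrite mul0n !expr0 hsubst1.
by rewrite mulSn !exprS hsubstM ?size_expr_leq // IHk.
Qed.

(** Substitution of pairs is associative: (g, h) consists of forms of degree
    r, so the composite has degree n * r. *)
Lemma hsubst_comp r n f g h u v : (size g <= r.+1)%N -> (size h <= r.+1)%N ->
  hsubst (n * r) (hsubst n f g h) u v =
  hsubst n f (hsubst r g u v) (hsubst r h u v).
Proof.
move=> sg sh; rewrite {2}/hsubst hsubst_sum; apply: eq_bigr => i _.
have le_in : (i <= n)%N by rewrite -ltnS.
have -> : (n * r = i * r + (n - i) * r)%N by rewrite -mulnDl subnKC.
by rewrite hsubstZ hsubstM ?size_expr_leq // !hsubst_exp.
Qed.

(** Seen as a form of degree n, a polynomial of degree at most m has a zero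
    of order n - m at infinity, that is, a factor Y^(n - m). *)
Lemma hsubst_widen m n f g h : (size f <= m.+1)%N -> (m <= n)%N ->
  hsubst n f g h = hsubst m f g h * h ^+ (n - m).
Proof.
move=> sf le_mn; rewrite -{1}(mulr1 f) -{1}(subnKC le_mn).
rewrite hsubstM ?size_poly1 //.
by rewrite -[X in hsubst (n - m) X](expr0 'X) hsubstXn // expr0 mul1r subn0.
Qed.

Lemma hsubst_lin g h u : hsubst 1 u g h = u`_0 *: h + u`_1 *: g.
Proof.
rewrite /hsubst big_ord_recl big_ord1 /=.
by rewrite expr0 !mul1r subn0 subnn expr0 mulr1.
Qed.

(** * Moebius transformations and their inverses *)

Definition mobdet u v : F := u`_1 * v`_0 - u`_0 * v`_1.

Definition mobius u v : Prop :=
  [/\ (size u <= 2)%N, (size v <= 2)%N & mobdet u v != 0].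

(** The adjugate of the matrix of u / v, that is, up to a scalar the inverse
    of the Moebius transformation u / v. *)
Definition adjnum u v : {poly F} := (- u`_0)%:P + v`_0 *: 'X.
Definition adjden u v : {poly F} := (u`_1)%:P + (- v`_1) *: 'X.

Lemma size_le2E u : (size u <= 2)%N -> u = (u`_0)%:P + u`_1 *: 'X.
Proof.
move/poly_sum_monomials=> {1}->; rewrite big_ord_recl big_ord1 /=.
by rewrite expr0 expr1 alg_polyC.
Qed.

Lemma coef0_lin (a b : F) : (a%:P + b *: 'X)`_0 = a.
Proof. by rewrite coefD coefC coefZ coefX mulr0 addr0. Qed.

Lemma coef1_lin (a b : F) : (a%:P + b *: 'X)`_1 = b.
Proof. by rewrite coefD coefC coefZ coefX mulr1 add0r. Qed.

Lemma size_lin (a b : F) : (size (a%:P + b *: 'X)%R <= 2)%N.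
Proof.
rewrite (leq_trans (size_polyD _ _)) // geq_max.
rewrite (leq_trans (size_polyC_leq1 _)) //=.
by rewrite (leq_trans (size_scale_leq _ _)) ?size_polyX.
Qed.

Lemma size_adjnum u v : (size (adjnum u v) <= 2)%N.
Proof. exact: size_lin. Qed.

Lemma size_adjden u v : (size (adjden u v) <= 2)%N.
Proof. exact: size_lin. Qed.

Lemma mobius_adj u v : mobius u v -> mobius (adjnum u v) (adjden u v).
Proof.
case=> su sv w0; rewrite /mobius size_adjnum size_adjden; split=> //.
by rewrite /mobdet /adjnum /adjden !coef0_lin !coef1_lin mulrNN mulrC.
Qed.

Lemma mobdet_adj u v : mobdet (adjnum u v) (adjden u v) = mobdet u v.
Proof.
by rewrite /mobdet /adjnum /adjden !coef0_lin !coef1_lin mulrNN mulrC.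
Qed.

Lemma adjK u v : (size u <= 2)%N -> (size v <= 2)%N ->
  adjnum (adjnum u v) (adjden u v) = u /\ adjden (adjnum u v) (adjden u v) = v.
Proof.
move=> su sv; rewrite /adjnum /adjden !coef0_lin !coef1_lin !opprK.
by rewrite -!size_le2E.
Qed.

(** With [hsubst_adjden]: the composite of u / v with its adjugate is
    the pair (D X, D), where D is the determinant. *)
Lemma hsubst_adjnum u v : (size u <= 2)%N -> (size v <= 2)%N ->
  hsubst 1 (adjnum u v) u v = mobdet u v *: 'X.
Proof.
move=> su sv; rewrite hsubst_lin /adjnum coef0_lin coef1_lin.
rewrite [in X in _ *: X + _](size_le2E sv) [in X in _ + _ *: X](size_le2E su).
by rewrite -!mul_polyC /mobdet; ring.
Qed.

Lemma hsubst_adjden u v : (size u <= 2)%N -> (size v <= 2)%N ->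
  hsubst 1 (adjden u v) u v = (mobdet u v)%:P.
Proof.
move=> su sv; rewrite hsubst_lin /adjden coef0_lin coef1_lin.
rewrite [in X in _ *: X + _](size_le2E sv) [in X in _ + _ *: X](size_le2E su).
by rewrite -!mul_polyC /mobdet; ring.
Qed.

Lemma hsubst_scaleX n f c : (size f <= n.+1)%N ->
  hsubst n f (c *: 'X) c%:P = c ^+ n *: f.
Proof.
move=> sf; rewrite -alg_polyC hsubst_scale; congr (_ *: _).
rewrite [RHS](poly_sum_monomials sf).
by apply: eq_bigr => i _; rewrite expr1n mulr1.
Qed.

Lemma hsubst_adjK n f u v : (size f <= n.+1)%N ->
  (size u <= 2)%N -> (size v <= 2)%N ->
  hsubst n (hsubst n f (adjnum u v) (adjden u v)) u v = mobdet u v ^+ n *: f.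
Proof.
move=> sf su sv; rewrite -{1}[n]muln1 hsubst_comp ?size_adjnum ?size_adjden //.
by rewrite hsubst_adjnum // hsubst_adjden // hsubst_scaleX.
Qed.

(** The same as [hsubst_adjK] with the roles exchanged, since the adjugate of
    the adjugate is the original pair. *)
Lemma hsubstK n f u v : (size f <= n.+1)%N ->
  (size u <= 2)%N -> (size v <= 2)%N ->
  hsubst n (hsubst n f u v) (adjnum u v) (adjden u v) = mobdet u v ^+ n *: f.
Proof.
move=> sf su sv; have [e1 e2] := adjK su sv.
have := @hsubst_adjK n f (adjnum u v) (adjden u v) sf.
rewrite e1 e2 mobdet_adj => -> //; first exact: size_adjnum.
exact: size_adjden.
Qed.

(** * The degree of a substitution *)

Lemma coef_top_mul m n p q : (size p <= m.+1)%N -> (size q <= n.+1)%N ->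
  (p * q)`_(m + n) = p`_m * q`_n.
Proof.
move=> sp sq; rewrite coefM.
have lt_m : (m < (m + n).+1)%N by rewrite ltnS leq_addr.
rewrite (bigD1 (Ordinal lt_m)) //= addKn big1 ?addr0 // => i ne_im.
have [lt_im|lt_mi|eq_im] := ltngtP i m; last first.
- by rewrite -val_eqE /= eq_im eqxx in ne_im.
- by rewrite nth_default ?mul0r // (leq_trans sp).
- rewrite [q`__]nth_default ?mulr0 // (leq_trans sq) //.
  by rewrite ltn_subRL ltn_add2r.
Qed.

Lemma coef_top_exp r k g : (size g <= r.+1)%N -> (g ^+ k)`_(k * r) = g`_r ^+ k.
Proof.
move=> sg; elim: k => [|k IHk]; first by rewrite mul0n !expr0 coef1.
by rewrite mulSn !exprS coef_top_mul ?size_expr_leq // IHk.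
Qed.

Lemma coef_top_hsubst r n f g h : (size g <= r.+1)%N -> (size h <= r.+1)%N ->
  (hsubst n f g h)`_(n * r) =
  \sum_(i < n.+1) f`_i * (g`_r ^+ i * h`_r ^+ (n - i)).
Proof.
move=> sg sh; rewrite coef_sum; apply: eq_bigr => i _; rewrite coefZ.
have le_in : (i <= n)%N by rewrite -ltnS.
have -> : (n * r = i * r + (n - i) * r)%N by rewrite -mulnDl subnKC.
by rewrite coef_top_mul ?size_expr_leq // !coef_top_exp.
Qed.

Lemma coef_last_neq0 n p : size p = n.+1 -> p`_n != 0.
Proof.
move=> sp; have := lead_coef_eq0 p; rewrite lead_coefE sp /= => ->.
by rewrite -size_poly_eq0 sp.
Qed.

(** A form with no zero on the projective line: a zero with y = 0 would kill
    the leading coefficient of f, any other one would be the root x / y. *)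
Lemma form_noroot_neq0 n f (x y : F) :
  size f = n.+1 -> (forall z, ~~ root f z) ->
  (x != 0) || (y != 0) -> \sum_(i < n.+1) f`_i * (x ^+ i * y ^+ (n - i)) != 0.
Proof.
move=> sf nroot; have [->|y0] := eqVneq y 0.
  rewrite orbF => x0; rewrite big_ord_recr /= subnn expr0 mulr1 big1 ?add0r.
    by rewrite mulf_neq0 ?expf_neq0 ?coef_last_neq0.
  by move=> i _; rewrite expr0n subn_eq0 leqNgt ltn_ord !mulr0.
move=> _; have -> : \sum_(i < n.+1) f`_i * (x ^+ i * y ^+ (n - i))
    = y ^+ n * f.[x / y].
  rewrite horner_coef sf mulr_sumr; apply: eq_bigr => i _.
  have le_in : (i <= n)%N by rewrite -ltnS.
  rewrite [RHS]mulrCA; congr (_ * _).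
  rewrite expr_div_n [RHS]mulrCA; congr (_ * _).
  by apply: (canRL (mulfK _)); rewrite ?expf_neq0 // -exprD subnK.
exact: mulf_neq0 (expf_neq0 n y0) (nroot _).
Qed.

Lemma irred_noroot n f : irreducible_poly f -> size f = n.+1 -> (1 < n)%N ->
  forall z, ~~ root f z.
Proof.
move=> irr sf n1 z; rewrite root_factor_theorem; apply/negP => dv.
have := irr.2 ('X - z%:P); rewrite size_XsubC => /(_ isT dv) /eqp_size.
by rewrite size_XsubC sf => -[] en; rewrite -en in n1.
Qed.

(** A reduced fraction of degree r, without the requirement that h be
    nonzero; in degree 0 this allows the constant infinity. *)
Definition reduced_pair r g h := coprimep g h /\ maxn (size g) (size h) = r.+1.

Lemma size_reduced_pair r g h : reduced_pair r g h ->
  (size g <= r.+1)%N /\ (size h <= r.+1)%N.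
Proof. by case=> _ <-; rewrite leq_maxl leq_maxr. Qed.

(** The coefficient in degree n * r is the form f at the coefficients of
    degree r of g and h, which are not both zero. *)
Lemma size_hsubst r n f g h :
  irreducible_poly f -> size f = n.+1 -> (1 < n)%N ->
  reduced_pair r g h -> size (hsubst n f g h) = (n * r).+1.
Proof.
move=> irr sf n1 ph; have [sg sh] := size_reduced_pair ph.
apply/eqP; rewrite eqn_leq size_hsubst_leq //= ltnNge.
apply/negP => /leq_sizeP/(_ _ (leqnn _))/eqP; apply/negP.
rewrite coef_top_hsubst // form_noroot_neq0 //; first exact: irred_noroot sf n1.
case: ph => _; rewrite /maxn.
by case: ltnP => _ /coef_last_neq0->; rewrite ?orbT.
Qed.

(** * Reduced pairs under composition *)

Lemma size_mul_unit p q : size q = 1 -> size (p * q) = size p.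
Proof.
by move/eqP/size_poly1P=> [c c0 ->]; rewrite mulrC mul_polyC size_scale.
Qed.

Lemma reduced_pair_neq0 r g h : reduced_pair r g h -> (g != 0) || (h != 0).
Proof.
case=> _ mx; rewrite -negb_and; apply/negP => /andP[/eqP g0 /eqP h0].
by move: mx; rewrite g0 h0 size_poly0.
Qed.

(** Suppose that d, of degree e, divides both transforms g1 and h1, and that
    these have degree at most s <= r.  As forms of degree r they then have the
    common factor d Y^(r - s), of degree e + (r - s).  Its transform K
    under the adjugate divides g and h, so it is constant, and dividing by it
    bounds the degrees of g and h by s - e.  Hence r <= s - e, so that e = 0
    and s = r: the first says that g1 and h1 are coprime, the second that
    their degree is r. *)
Lemma reduced_pair_precomp r g h u v : mobius u v -> reduced_pair r g h ->
  reduced_pair r (hsubst r g u v) (hsubst r h u v).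
Proof.
move=> [su sv w0] pgh; have [sg sh] := size_reduced_pair pgh.
set g1 := hsubst r g u v; set h1 := hsubst r h u v.
have wr0 : mobdet u v ^+ r != 0 by rewrite expf_neq0.
have nz1 : (g1 != 0) || (h1 != 0).
  have back p : (size p <= r.+1)%N -> hsubst r p u v = 0 -> p = 0.
    move=> sp p0; apply/eqP; rewrite -size_poly_eq0 -(size_scale p wr0).
    rewrite -hsubstK // p0 -(scale0r (0 : {poly F})) hsubstZ !scale0r.
    by rewrite size_poly0.
  by apply: contraLR (reduced_pair_neq0 pgh); rewrite -!negb_and !negbK =>
    /andP[/eqP/back-> // /eqP/back-> //]; rewrite eqxx.
have core s d : (s <= r)%N -> (size g1 <= s.+1)%N -> (size h1 <= s.+1)%N ->
    d %| g1 -> d %| h1 -> size d = 1 /\ s = r.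
  move=> le_sr sg1 sh1 dg dh.
  have d0 : d != 0.
    by apply: contraL nz1 => /eqP d0; move: dg dh; rewrite d0 !dvd0p => -> ->.
  have [e sd] : exists e, size d = e.+1.
    by exists (size d).-1; rewrite prednK // size_poly_gt0.
  have le_es : (e <= s)%N.
    rewrite -ltnS -sd; case/orP: nz1 => nz.
      exact: leq_trans (dvdp_leq nz dg) sg1.
    exact: leq_trans (dvdp_leq nz dh) sh1.
  pose K := hsubst e d (adjnum u v) (adjden u v) * adjden u v ^+ (r - s).
  have fact p : (size p <= r.+1)%N -> (size (hsubst r p u v) <= s.+1)%N ->
      d %| hsubst r p u v ->
      exists2 q : {poly F}, (size q <= (s - e).+1)%N
        & mobdet u v ^+ r *: p = q * K.
    move=> sp sp1 dp; set q := hsubst r p u v %/ d.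
    have sq : (size q <= (s - e).+1)%N.
      by rewrite size_divp // sd /= -subSn // leq_sub2r.
    exists (hsubst (s - e) q (adjnum u v) (adjden u v)).
      rewrite -{2}[(s - e)%N]muln1 size_hsubst_leq ?size_adjnum ?size_adjden //.
    rewrite -hsubstK // (@hsubst_widen s) // -(divpK dp) -/q.
    by rewrite -{1}(subnK le_es) hsubstM ?sd // /K mulrA.
  have [qg sqg Eg] := fact g sg sg1 dg.
  have [qh sqh Eh] := fact h sh sh1 dh.
  have sK : size K = 1.
    apply/eqP; case: pgh => /coprimepP cop _; rewrite size_poly_eq1.
    by apply: cop; rewrite -(dvdpZr _ _ wr0) ?Eg ?Eh dvdp_mull.
  have : (r.+1 <= (s - e).+1)%N.
    case: pgh => _ <-; rewrite geq_max -(size_scale g wr0) -(size_scale h wr0).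
    by rewrite Eg Eh !(size_mul_unit _ sK) sqg.
  rewrite ltnS sd => le_r; have e0 : e = 0%N.
    apply/eqP; rewrite -leqn0 -(leq_add2r (s - e)) subnKC // add0n.
    exact: leq_trans le_sr le_r.
  rewrite e0 subn0 in le_r *; split=> //; apply/eqP.
  by rewrite eqn_leq le_sr.
have sg1 : (size g1 <= r.+1)%N.
  by rewrite -[X in (_ <= X.+1)%N]muln1 size_hsubst_leq.
have sh1 : (size h1 <= r.+1)%N.
  by rewrite -[X in (_ <= X.+1)%N]muln1 size_hsubst_leq.
split.
  rewrite coprimep_def; apply/eqP.
  have [] // := core r (gcdp g1 h1) (leqnn r) sg1 sh1.
    exact: dvdp_gcdl.
  exact: dvdp_gcdr.
have mx0 : (0 < maxn (size g1) (size h1))%N.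
  by rewrite leq_max !size_poly_gt0.
rewrite -(prednK mx0); congr _.+1.
(* With d = 1 and s the larger of the actual degrees, s = r. *)
have [] // := core (maxn (size g1) (size h1)).-1 1;
  rewrite ?prednK ?leq_maxl ?leq_maxr ?dvd1p //.
by rewrite -ltnS prednK // geq_max sg1.
Qed.

Lemma hsubst1_adj g h u v : (size u <= 2)%N -> (size v <= 2)%N ->
  hsubst 1 (adjnum u v) (hsubst 1 u g h) (hsubst 1 v g h) = mobdet u v *: g /\
  hsubst 1 (adjden u v) (hsubst 1 u g h) (hsubst 1 v g h) = mobdet u v *: h.
Proof.
move=> su sv; rewrite !hsubst_lin /adjnum /adjden !coef0_lin !coef1_lin.
by rewrite -!mul_polyC /mobdet; split; ring.
Qed.

Lemma size_hsubst1_leq r u g h : (size g <= r.+1)%N -> (size h <= r.+1)%N ->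
  (size (hsubst 1 u g h) <= r.+1)%N.
Proof. by move=> sg sh; rewrite -[r]mul1n size_hsubst_leq. Qed.

Lemma dvdp_hsubst1 d u g h : d %| g -> d %| h -> d %| hsubst 1 u g h.
Proof.
move=> dg dh; rewrite hsubst_lin -!mul_polyC.
by rewrite dvdp_add // dvdp_mull.
Qed.

(** A linear combination of g and h has no larger degree and keeps their
    common divisors, and the adjugate combinations recover g and h. *)
Lemma reduced_pair_postcomp r g h u v : mobius u v -> reduced_pair r g h ->
  reduced_pair r (hsubst 1 u g h) (hsubst 1 v g h).
Proof.
move=> [su sv w0] [/coprimepP cop mx]; have [E1 E2] := hsubst1_adj g h su sv.
set g1 := hsubst 1 u g h in E1 E2 *; set h1 := hsubst 1 v g h in E1 E2 *.
split.
  apply/coprimepP => d dg dh; apply: cop.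
    by rewrite -(dvdpZr _ _ w0) -E1 dvdp_hsubst1.
  by rewrite -(dvdpZr _ _ w0) -E2 dvdp_hsubst1.
have [sg sh] : (size g <= r.+1)%N /\ (size h <= r.+1)%N.
  by rewrite -mx leq_maxl leq_maxr.
apply/eqP; rewrite eqn_leq geq_max !size_hsubst1_leq //= -mx.
have [m Em] : exists m, maxn (size g1) (size h1) = m.+1.
  case Em: (maxn (size g1) (size h1)) => [|m]; last by exists m.
  move: (leq_maxl (size g1) (size h1)) (leq_maxr (size g1) (size h1)).
  rewrite Em !leqn0 !size_poly_eq0 => /eqP g10 /eqP h10.
  move: mx; rewrite -(size_scale g w0) -(size_scale h w0) -E1 -E2 g10 h10.
  by rewrite !hsubst_lin !scaler0 addr0 size_poly0.
rewrite Em geq_max -(size_scale g w0) -(size_scale h w0) -E1 -E2.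
have [sg1 sh1] : (size g1 <= m.+1)%N /\ (size h1 <= m.+1)%N.
  by rewrite -Em leq_maxl leq_maxr.
by rewrite !(size_hsubst1_leq _ sg1 sh1).
Qed.

Lemma reduced_pair_den_neq0 r g h : (0 < r)%N -> reduced_pair r g h -> h != 0.
Proof.
move=> r0 [cop mx]; apply: contraTneq r0 => h0; move: cop mx.
by rewrite h0 coprimep0 -size_poly_eq1 size_poly0 maxn0 => /eqP-> [<-].
Qed.

(** If the determinant vanished, then the member of degree 1 would divide the
    other one. *)
Lemma reduced_pair_mobius u v : reduced_pair 1 u v -> mobius u v.
Proof.
move=> puv; have [su sv] := size_reduced_pair puv; split=> //.
have [cop mx] := puv; apply/negP; rewrite subr_eq0 => /eqP w0.
have absurd p q : (size p <= 2)%N -> (size q <= 2)%N -> coprimep p q ->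
    p`_1 * q`_0 = p`_0 * q`_1 -> size p != 2.
  move=> sp sq copq e; apply/eqP => sp2.
  have p1 : p`_1 != 0 by exact: coef_last_neq0.
  have dpq : p %| q.
    rewrite -(dvdpZr _ _ p1); suff -> : p`_1 *: q = q`_1 *: p.
      by rewrite -mul_polyC dvdp_mull.
    rewrite [in LHS](size_le2E sq) [in RHS](size_le2E sp) !scalerDr !scalerA.
    by rewrite -!alg_polyC !scalerA e [q`_1 * p`_0]mulrC [q`_1 * _]mulrC.
  move/coprimepP: copq => /(_ p (dvdpp p) dpq).
  by rewrite -size_poly_eq1 sp2.
move: mx; rewrite /maxn; case: ltnP => _; apply/eqP; last exact: absurd w0.
apply: absurd su _ _ => //; first by rewrite coprimep_sym.
by rewrite mulrC -w0 mulrC.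
Qed.

Lemma mobius_reduced_pair u v : mobius u v -> reduced_pair 1 u v.
Proof.
move=> mob; have [su sv _] := mob.
(* (u, v) is the combination by u and v of the reduced pair (X, 1). *)
have id1 p : (size p <= 2)%N -> hsubst 1 p 'X 1 = p.
  by move=> sp; rewrite hsubst_lin alg_polyC -size_le2E.
rewrite -[u]id1 // -[v in reduced_pair _ _ v]id1 //.
apply: reduced_pair_postcomp => //.
by split; rewrite ?coprimep1 // size_polyX size_poly1.
Qed.

(** * Irreducibility under Moebius transformations *)

Lemma irredZ c f : c != 0 -> irreducible_poly (c *: f) -> irreducible_poly f.
Proof.
move=> c0 [sf irr]; split=> [|q sq]; first by rewrite -(size_scale f c0).
rewrite -(dvdpZr _ _ c0) => /(irr q sq).
by rewrite (eqp_rtrans (eqp_scale f c0)).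
Qed.

(** A factorization of the transform of f is carried back by the adjugate to
    one of f, in which the degrees of the factors cannot increase; as they add
    up to n again, they are preserved, so the factorization is trivial. *)
Lemma irred_hsubst n f u v : mobius u v -> size f = n.+1 ->
  size (hsubst n f u v) = n.+1 ->
  irreducible_poly f -> irreducible_poly (hsubst n f u v).
Proof.
move=> [su sv w0] sf sP irr; set P := hsubst n f u v in sP *.
have wn0 : mobdet u v ^+ n != 0 by rewrite expf_neq0.
have P0 : P != 0 by rewrite -size_poly_eq0 sP.
split=> [|q sq dq]; first by rewrite sP -sf irr.1.
have q0 : q != 0 by apply: contraTneq dq => ->; rewrite dvd0p.
have [e eq_e] : exists e, size q = e.+1.
  by exists (size q).-1; rewrite prednK // size_poly_gt0.
have le_en : (e <= n)%N by rewrite -ltnS -eq_e -sP dvdp_leq.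
set k := P %/ q.
have sk : (size k <= (n - e).+1)%N by rewrite size_divp // eq_e sP -subSn.
pose q' := hsubst e q (adjnum u v) (adjden u v).
pose k' := hsubst (n - e) k (adjnum u v) (adjden u v).
have Ef : mobdet u v ^+ n *: f = k' * q'.
  by rewrite -hsubstK ?sf // -/P -(divpK dq) -{1}(subnK le_en) hsubstM ?eq_e.
have sizes m p : (size (hsubst m p (adjnum u v) (adjden u v)) <= m.+1)%N.
  by rewrite -{2}[m]muln1 size_hsubst_leq ?size_adjnum ?size_adjden.
have [sq'|sq'] := eqVneq (size q') 1.
  have : (n.+1 <= (n - e).+1)%N.
    by rewrite -sf -(size_scale f wn0) Ef size_mul_unit ?sizes.
  rewrite ltnS => le_n; move: sq; rewrite eq_e.
  suff -> : e = 0%N by [].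
  by apply/eqP; rewrite -leqn0 -(leq_add2r (n - e)) subnKC.
have dq' : q' %| f by rewrite -(dvdpZr _ _ wn0) Ef dvdp_mull.
rewrite -dvdp_size_eqp // sP -sf -(eqp_size (irr.2 q' sq' dq')) eqn_leq.
by rewrite eq_e sizes andbT (eqp_size (irr.2 q' sq' dq')) sf ltnS.
Qed.

(** The equality of degrees excludes that the transformation moves a root
    of one of the polynomials to infinity. *)
Lemma irred_hsubstE n f u v : mobius u v -> size f = n.+1 ->
  size (hsubst n f u v) = n.+1 ->
  irreducible_poly f <-> irreducible_poly (hsubst n f u v).
Proof.
move=> mob sf sP; split; first exact: irred_hsubst.
have [su sv w0] := mob; have wn0 : mobdet u v ^+ n != 0 by rewrite expf_neq0.
move=> irr; apply: (irredZ wn0); rewrite -hsubstK ?sf //.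
apply: irred_hsubst; rewrite ?hsubstK ?sf ?size_scale //.
exact: mobius_adj.
Qed.

(** * Rational expressions as reduced pairs *)

Lemma reduced_pair_rdeg (T : {ratexpr F}) : (0 < rdeg T)%N ->
  reduced_pair (rdeg T) (rnum T) (rden T).
Proof.
have [d0 cop _] := rnum_rden_lowest T; split=> //; move: H; rewrite /rdeg.
by have := d0; rewrite -size_poly_gt0; case: (size (rden T)) => // b _;
  case: (size (rnum T)) => [|a] //=; rewrite ?maxnSS // !max0n.
Qed.

Lemma lowest_terms_uniq (T : {ratexpr F}) g h g' h' :
  lowest_terms T g h -> lowest_terms T g' h' ->
  exists2 c, c != 0 & g' = c *: g /\ h' = c *: h.
Proof.
move=> [h0 cop ET] [h'0 cop' ET'].
have E : g' * h = g * h'.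
  apply/eqP; rewrite -tofrac_eq !tofracM.
  by rewrite -eqr_div ?tofrac_eq0 // -ET -ET'.
have : h %= h'.
  rewrite /eqp -(@Gauss_dvdpr _ _ g) 1?coprimep_sym // -E dvdp_mull //=.
  by rewrite -(@Gauss_dvdpr _ _ g') 1?coprimep_sym // E dvdp_mull.
case/eqpP=> -[a b] /= /andP[a0 b0] Eh.
have Eh' : h' = (b^-1 * a) *: h by rewrite -scalerA Eh scalerA mulVf ?scale1r.
exists (b^-1 * a); first by rewrite mulf_neq0 ?invr_neq0.
by split=> //; apply: (mulIf h0); rewrite E Eh' -scalerAl -scalerAr.
Qed.

(** Both the numerator and the denominator of S o T are multiplied by v^r. *)
Lemma rcompE r (S T : {ratexpr F}) u v :
  v != 0 -> T = u%:F / v%:F -> (rdeg S <= r)%N ->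
  rcomp S T =
  (hsubst r (rnum S) u v)%:F / (hsubst r (rden S) u v)%:F.
Proof.
move=> v0 ->; rewrite /rdeg geq_max => /andP[sn sd].
have cancel (K : fieldType) (z x y : K) : z != 0 -> x / y = (z * x) / (z * y).
  by move=> z0; rewrite -mulf_div divff // mul1r.
have vr0 : v%:F ^+ r != 0 by rewrite expf_neq0 // tofrac_eq0.
have sn' : (size (rnum S) <= r.+1)%N by rewrite (leq_trans (leqSpred _)).
have sd' : (size (rden S) <= r.+1)%N by rewrite (leq_trans (leqSpred _)).
rewrite (hsubstE u v0 sn') (hsubstE u v0 sd').
exact: cancel.
Qed.

End BinaryForms.

Section Counting.
Set Implicit Arguments.
Unset Strict Implicit.
Import GRing.Theory.
Variable F : finFieldType.
Implicit Types (g h u v : {poly F}).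

(** * Counting *)

Lemma Iset_scale c g h n : c != 0 -> Iset (c *: g) (c *: h) n = Iset g h n.
Proof.
move=> c0; apply/setP => f; rewrite !inE hsubst_scale.
have cn0 : c ^+ n != 0 by rewrite expf_neq0.
do 3![congr (_ && _)]; apply/irreducibleP/irreducibleP; first exact: irredZ.
move=> irr; apply: (@irredZ _ (c ^+ n)^-1); first by rewrite invr_neq0.
by rewrite scalerA mulVf ?scale1r.
Qed.

(** The polynomials to be irreducible on the two sides are a form of degree
    n * r and its transform under (u, v). *)
Lemma Iset_precomp r g h u v n : (1 < n)%N ->
  reduced_pair r g h -> mobius u v ->
  Iset (hsubst r g u v) (hsubst r h u v) n = Iset g h n.
Proof.
move=> n1 pgh mob; have [sg sh] := size_reduced_pair pgh.
apply/setP => f; rewrite !inE; apply: andb_id2l => /eqP sf; congr (_ && _).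
apply: andb_id2l => /irreducibleP irr; rewrite -hsubst_comp //.
have sP := size_hsubst irr sf n1 pgh.
have sPA := size_hsubst irr sf n1 (reduced_pair_precomp mob pgh).
rewrite -hsubst_comp // in sPA.
by apply/irreducibleP/irreducibleP => /(irred_hsubstE mob sP sPA).
Qed.

(** The monic multiple of the transform of f under (u, v) is an injective
    function of the monic f, as [hsubstK] recovers f up to a scalar. *)
Lemma leq_Iset_postcomp r g h u v n : (1 < n)%N ->
  reduced_pair r g h -> mobius u v ->
  (#|Iset (hsubst 1 u g h) (hsubst 1 v g h) n| <= #|Iset g h n|)%N.
Proof.
move=> n1 pgh mob; have [su sv w0] := mob.
have puv := mobius_reduced_pair mob.
pose P (f : {poly F}) := hsubst n f u v.
pose phi (f : {poly_(n.+1) F}) : {poly_(n.+1) F} :=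
  npolyp n.+1 ((lead_coef (P f))^-1 *: P f).
have props f : f \in Iset (hsubst 1 u g h) (hsubst 1 v g h) n ->
  [/\ size f = n.+1, val f \is monic, irreducible_poly (val f),
      size (P f) = n.+1 & irreducible_poly (hsubst n (P f) g h)].
  rewrite inE => /and4P[/eqP sf mon /irreducibleP irr /irreducibleP irr2].
  split=> //; first by rewrite (size_hsubst irr sf n1 puv) muln1.
  by rewrite /P -[X in hsubst X _ g h]muln1 hsubst_comp.
have val_phi f : f \in Iset (hsubst 1 u g h) (hsubst 1 v g h) n ->
    lead_coef (P f) != 0 /\ phi f = (lead_coef (P f))^-1 *: P f :> {poly F}.
  case/props => _ _ _ sP _; have l0 : lead_coef (P f) != 0.
    by rewrite lead_coef_eq0 -size_poly_eq0 sP.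
  by split=> //; apply: npolypK; rewrite size_scale ?invr_neq0 // sP.
rewrite -(@card_in_imset _ _ phi).
  apply/subset_leq_card/subsetP => _ /imsetP[f fI ->].
  have [sf mon irr sP irr2] := props f fI; have [l0 Ephi] := val_phi f fI.
  have li0 : (lead_coef (P f))^-1 != 0 by rewrite invr_neq0.
  rewrite inE /= Ephi size_scale // sP eqxx monicE lead_coefZ mulVf // eqxx /=.
  apply/andP; split; apply/irreducibleP.
    apply: (irredZ l0); rewrite scalerA mulfV // scale1r.
    by apply: irred_hsubst.
  by apply: (irredZ l0); rewrite hsubstZ scalerA mulfV // scale1r.
move=> f1 f2 fI1 fI2 /(congr1 val) /=; have [l1 ->] := val_phi f1 fI1.
have [l2 ->] := val_phi f2 fI2.
move/(congr1 (fun p => hsubst n p (adjnum u v) (adjden u v))).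
have [sf1 mon1 _ _ _] := props f1 fI1; have [sf2 mon2 _ _ _] := props f2 fI2.
have wn0 : mobdet u v ^+ n != 0 by rewrite expf_neq0.
rewrite !hsubstZ !hsubstK ?sf1 ?sf2 // !scalerA => E.
apply/val_inj/eqP; rewrite -eqp_monic //; apply/eqpP.
exists ((lead_coef (P f1))^-1 * mobdet u v ^+ n,
        (lead_coef (P f2))^-1 * mobdet u v ^+ n) => //=.
by rewrite !mulf_neq0 ?invr_neq0.
Qed.

Lemma card_Iset_postcomp r g h u v n : (1 < n)%N ->
  reduced_pair r g h -> mobius u v ->
  #|Iset (hsubst 1 u g h) (hsubst 1 v g h) n| = #|Iset g h n|.
Proof.
move=> n1 pgh mob; have [su sv w0] := mob.
apply/eqP; rewrite eqn_leq (leq_Iset_postcomp n1 pgh mob) /=.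
rewrite -(Iset_scale g h n w0); have [<- <-] := hsubst1_adj g h su sv.
have := reduced_pair_postcomp mob pgh; have := mobius_adj mob.
by move=> mob' pgh'; exact: leq_Iset_postcomp n1 pgh' mob'.
Qed.

End Counting.

Theorem lemma2 (F : finFieldType) (R A B : {ratexpr F})
    (g h gt ht : {poly F}) (r : nat)
    (hR : lowest_terms R g h) (hr : (1 <= r)%N) (hdeg : rdeg R = r)
    (hA : linear_ratexpr A) (hB : linear_ratexpr B)
    (hRt : lowest_terms (rcomp B (rcomp R A)) gt ht)
    (n : nat) (hn : (1 < n)%N) :
  #|Iset gt ht n| = #|Iset g h n|.
Proof.
have R0 : (0 < rdeg R)%N by rewrite hdeg.
have [c c0 [-> ->]] := lowest_terms_uniq (rnum_rden_lowest R) hR.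
have pR := reduced_pair_rdeg R0; have [hA0 _ EA] := rnum_rden_lowest A.
have pA : reduced_pair 1 (rnum A) (rden A).
  by rewrite -{1}hA; apply: reduced_pair_rdeg; rewrite hA.
have pB : reduced_pair 1 (rnum B) (rden B).
  by rewrite -{1}hB; apply: reduced_pair_rdeg; rewrite hB.
have mA := reduced_pair_mobius pA.
have mB := reduced_pair_mobius pB.
have pRA := reduced_pair_precomp mA pR.
have RA0 := reduced_pair_den_neq0 R0 pRA.
have pBRA := reduced_pair_postcomp mB pRA.
have BRA0 := reduced_pair_den_neq0 R0 pBRA.
have ERA := rcompE hA0 EA (leqnn (rdeg R)).
have hB1 : (rdeg B <= 1)%N by rewrite hB.
have EBRA := rcompE RA0 ERA hB1.
have lBRA := And3 BRA0 pBRA.1 EBRA.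
have [c' c'0 [-> ->]] := lowest_terms_uniq lBRA hRt.
rewrite !Iset_scale // (card_Iset_postcomp hn pRA mB).
by rewrite (Iset_precomp hn pR mA).
Qed.
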